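(* Let $(\Omega,\mathcal F,\Pr)$ be a probability space with filtration $\{\mathcal F_n\}_{n\ge0}$, let $\alpha>0$, $\xi>0$, and let $\{T_n\}_{n\ge0}\subset(0,1)$ be strictly decreasing and deterministic with $\sum_nT_n=\infty$, $\sum_nT_n^2<\infty$. Let $\{z_n\}$ be non-negative and adapted with $\mathbb{E}[z_{n+1}\mid\mathcal F_n]\le(1-\alpha T_n)z_n+\xi T_n$ a.s., and suppose there is a constant $B_1\ge\alpha$ with $|z_{n+1}-z_n|\le B_1T_n(z_n+1)$ a.s. for all $n$. Assume in addition that there is a constant $\eta>0$ with (A1) $\liminf_{n\to\infty} nT_n>\frac{\eta}{2\alpha}$; and (A2) $\sum_n (n+1)^\eta T_n^2<\infty$. Then $$\lim_{n\to\infty} n^{\eta/2}\, d\big(z_n,[0,\xi/\alpha]\big)=0\quad\text{a.s.}$$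
   Context: For $z\in\mathbb R$ and an interval $Z\subset\mathbb R$, $d(z,Z)\doteq\inf_{\tilde z\in Z}|z-\tilde z|$. *)

(* Defs.v *)
From HB Require Import structures.
From mathcomp Require Import all_boot all_order all_algebra.
From mathcomp Require Import all_classical all_reals all_analysis measurable_realfun.
Set Implicit Arguments. Unset Strict Implicit. Unset Printing Implicit Defensive.
Import Order.TTheory GRing.Theory Num.Theory.
Import numFieldNormedType.Exports.
Local Open Scope classical_set_scope.
Local Open Scope ring_scope.

Definition dist_set (R : realType) (z : R) (Z : set R) : R :=
  inf [set `|z - t| | t in Z].

Definition sub_sigma_algebra d (T : measurableType d) (G : set (set T)) : Prop :=
  sigma_algebra setT G /\ G `<=` measurable.

Definition filtration d (T : measurableType d) (F : nat -> set (set T)) : Prop :=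
  (forall n, sub_sigma_algebra (F n)) /\ (forall n, F n `<=` F n.+1).

Definition G_measurable d (T : measurableType d) (R : realType)
  (G : set (set T)) (f : T -> R) : Prop :=
  forall B : set R, measurable B -> G (f @^-1` B).

Definition G_emeasurable d (T : measurableType d) (R : realType)
  (G : set (set T)) (f : T -> \bar R) : Prop :=
  forall B : set (\bar R), measurable B -> G (f @^-1` B).

(* Y is a version of the conditional expectation E[X | G] for X >= 0
   (extended-valued, possibly infinite) *)
Definition is_cond_exp d (T : measurableType d) (R : realType)
  (P : probability T R) (G : set (set T)) (X : T -> R) (Y : T -> \bar R) : Prop :=
  G_emeasurable G Y /\ (forall x, (0 <= Y x)%E) /\
  forall A, G A -> (\int[P]_(x in A) (X x)%:E = \int[P]_(x in A) Y x)%E.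

(* Main.v *)
Require Import Defs.
From HB Require Import structures.
From mathcomp Require Import all_boot all_order all_algebra.
From mathcomp Require Import all_classical all_reals all_analysis measurable_realfun.
From mathcomp Require Import ring lra.
Import Order.TTheory GRing.Theory Num.Theory.
Import numFieldNormedType.Exports.
Local Open Scope classical_set_scope.
Local Open Scope ring_scope.

(** With [c = xi / alpha], the distance of [z_n] to [[0, c]] is
    [y_n = max(z_n - c, 0)].  Expanding the square and using the drift and the
    increment bound gives, conditionally on [F_n],
    [E y_{n+1}^2 <= (1 - 2 alpha T_n + 2 B1^2 T_n^2) y_n^2 + C T_n^2].
    By (A1) the factor is eventually at most [(n / (n+1))^(eta + del)] for some
    [del > 0], so [W_n = n^eta y_n^2] satisfies
    [E W_{n+1} <= (n / (n+1))^del W_n + b_n], where [sum_n b_n] converges by (A2).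
    On the events [z_N <= M], where [W_N] is integrable, the expectations of
    [W_n] therefore tend to [0], and Doob's maximal inequality started at a late
    time [m] bounds the probability that [W] exceeds a given level after [m] by
    [E W_m + sum_{k >= m} b_k] up to a constant; hence [W_n -> 0] almost surely. *)

(** * Powers of integers, the distance to a segment, lower limits and series of reals *)

Section real_lemmas.
Set Implicit Arguments.
Unset Strict Implicit.
Variable R : realType.

(** Since [(1 + 1/n)^s <= exp(s/n)] and [1 - s/n <= exp(-s/n)], the two exponentials cancel. This is
    how a contraction factor [1 - s/n] becomes a ratio of powers. *)
Lemma powR_natS_le (s : R) (n : nat) : 0 <= s -> (0 < n)%N ->
  n.+1%:R `^ s * (1 - s / n%:R) <= n%:R `^ s.
Proof.
move=> s0 n0; have nR : (0 : R) < n%:R by rewrite ltr0n.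
have -> : n.+1%:R = n%:R * (1 + n%:R^-1) :> R.
  by rewrite mulrDr mulr1 divff ?gt_eqF// -natr1.
have inv0 : (0 : R) < n%:R^-1 by rewrite invr_gt0.
rewrite powRM// -mulrA ler_piMr ?powR_ge0//.
rewrite /powR gt_eqF ?addr_gt0//.
have le1 : expR (s * ln (1 + n%:R^-1)) <= expR (s / n%:R).
  by rewrite ler_expR ler_wpM2l// le_ln1Dx// (lt_trans _ inv0)// ltrN10.
have le2 : 1 - s / n%:R <= expR (- (s / n%:R)) := expR_ge1Dx _.
apply: (le_trans (ler_wpM2l (expR_ge0 _) le2)).
apply: (le_trans (ler_wpM2r (expR_ge0 _) le1)).
by rewrite -expRD subrr expR0.
Qed.

Lemma dist_set_segment (c x : R) : 0 <= c -> 0 <= x ->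
  dist_set x `[0, c] = Num.max (x - c) 0.
Proof.
move=> c0 x0; apply/eqP; rewrite eq_le; apply/andP; split.
- apply: ge_inf; first by exists 0 => _ [t _ <-].
  have [xc|cx] := leP x c.
    by exists x; rewrite /= ?in_itv/= ?x0 ?xc// subrr normr0 max_r// subr_le0.
  exists c; rewrite /= ?in_itv/= ?c0 ?lexx//.
  by rewrite ger0_norm ?max_l// subr_ge0 ltW.
- apply: lb_le_inf; first by exists `|x - 0|, 0 => //=; rewrite in_itv/= lexx c0.
  move=> _ [t /= + <-]; rewrite in_itv/= => /andP[_ tc].
  rewrite ge_max normr_ge0 andbT (le_trans _ (ler_norm _))//.
  by rewrite lerD2l lerN2.
Qed.

(** A real [b] strictly between [a] and the lower limit is eventually exceeded by the tail infima.
    The gap [b - a] later supplies the extra decay exponent [del]. *)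
Lemma limn_einf_gt (u : nat -> R) (a : R) :
  (a%:E < limn_einf (fun n => (u n)%:E))%E ->
  exists2 b, a < b & \forall n \near \oo, b <= u n.
Proof.
move=> h; have [b ab hb] : exists2 b, a < b &
    (b%:E < limn_einf (fun n => (u n)%:E))%E.
  case: (limn_einf _) h => [l| |] //.
  - rewrite lte_fin => al; exists ((a + l) / 2); rewrite ?lte_fin; lra.
  - by move=> _; exists (a + 1); rewrite ?ltry//; lra.
exists b => //; move: hb; rewrite limn_einf_lim => hb.
have [N _ hN] := lte_lim (@nondecreasing_einfs _ _) (@is_cvg_einfs _ _) hb.
exists N => // n /= Nn; rewrite -lee_fin.
apply: (le_trans (hN N _)) => //=.
by apply: ereal_inf_lbound; exists n.
Qed.

Lemma nneseries_EFin_cvgn (u : nat -> R) : (forall n, 0 <= u n) ->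
  (\sum_(0 <= k <oo) (u k)%:E < +oo)%E -> cvgn (series u).
Proof.
move=> u0 fin; apply: nondecreasing_is_cvgn.
  by apply: nondecreasing_series => n *; exact: u0.
have S0 : (0 <= \sum_(0 <= k <oo) (u k)%:E)%E.
  by apply: nneseries_ge0 => n _ _; rewrite lee_fin.
exists (fine (\sum_(0 <= k <oo) (u k)%:E)%E) => _ [n _ <-].
rewrite -lee_fin fineK ?ge0_fin_numE// /series/= -sumEFin.
by apply: nneseries_lim_ge => k _ _; rewrite lee_fin.
Qed.

Lemma cvgn_series_tail (u : nat -> R) : (forall n, 0 <= u n) ->
  cvgn (series u) -> forall e, 0 < e ->
  \forall m \near \oo, forall n, \sum_(m <= k < n) u k <= e.
Proof.
move=> u0 cu e e0.
have nd : nondecreasing_seq (series u).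
  by apply: nondecreasing_series => n *; exact: u0.
have /cvgrPdist_le /(_ _ e0)[N _ hN] := cu.
exists N => // m /= Nm n; have [mn|nm] := leqP m n; last first.
  by rewrite big_geq ?ltW// ltnW.
rewrite -sub_series_geq//.
have := hN _ Nm; rewrite ger0_norm; last first.
  by rewrite subr_ge0; exact: nondecreasing_cvgn_le.
by apply: le_trans; rewrite lerD2r; exact: nondecreasing_cvgn_le.
Qed.

End real_lemmas.

(** * Integrals of non-negative real functions *)

Section ge0_real_integral.
Set Implicit Arguments.
Unset Strict Implicit.
Context d (T : measurableType d) (R : realType) (mu : {measure set T -> \bar R}).
Implicit Types (D : set T) (f g : T -> R).

Lemma ge0_integral_EFinD D f g : measurable D ->
  measurable_fun setT f -> measurable_fun setT g ->
  (forall x, 0 <= f x) -> (forall x, 0 <= g x) ->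
  (\int[mu]_(x in D) (f x + g x)%:E =
   \int[mu]_(x in D) (f x)%:E + \int[mu]_(x in D) (g x)%:E)%E.
Proof.
move=> mD mf mg f0 g0; under eq_integral do rewrite EFinD.
apply: ge0_integralD => // [x _||x _|]; rewrite ?lee_fin//.
- exact/measurable_EFinP/measurable_funTS.
- exact/measurable_EFinP/measurable_funTS.
Qed.

Lemma ge0_integral_EFinZl D (k : R) f : measurable D ->
  measurable_fun setT f -> 0 <= k -> (forall x, 0 <= f x) ->
  (\int[mu]_(x in D) (k * f x)%:E = k%:E * \int[mu]_(x in D) (f x)%:E)%E.
Proof.
move=> mD mf k0 f0; under eq_integral do rewrite EFinM.
apply: ge0_integralZl_EFin => // [x _|]; first by rewrite lee_fin.
exact/measurable_EFinP/measurable_funTS.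
Qed.

Lemma ge0_le_integral_EFin D f g : measurable D ->
  measurable_fun setT f -> measurable_fun setT g ->
  (forall x, 0 <= f x) -> (forall x, D x -> f x <= g x) ->
  (\int[mu]_(x in D) (f x)%:E <= \int[mu]_(x in D) (g x)%:E)%E.
Proof.
move=> mD mf mg f0 fg; apply: ge0_le_integral => // [x _||].
- by rewrite lee_fin.
- exact/measurable_EFinP/measurable_funTS.
- exact/measurable_EFinP/measurable_funTS.
Qed.

End ge0_real_integral.

(** * Sub-sigma-algebras and multiplication by a known factor under the integral *)

Section sub_sigma_algebra.
Set Implicit Arguments.
Unset Strict Implicit.
Context d (T : measurableType d) (R : realType).
Implicit Types (G : set (set T)).

Lemma sub_sigma_algebraI G A B : Defs.sub_sigma_algebra G -> G A -> G B ->
  G (A `&` B).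
Proof.
move=> [/sigma_algebraP sG _] GA GB.
by have [|_ _ _] := sG; [move=> X _; exact: subsetT|exact].
Qed.

Lemma G_measurable_fun G (f : T -> R) : Defs.sub_sigma_algebra G ->
  G_measurable G f -> measurable_fun setT f.
Proof. by move=> [_ Gm] mf _ B mB; rewrite setTI; apply/Gm/mf. Qed.

Lemma G_emeasurable_fun G (f : T -> \bar R) : Defs.sub_sigma_algebra G ->
  G_emeasurable G f -> measurable_fun setT f.
Proof. by move=> [_ Gm] mf _ B mB; rewrite setTI; apply/Gm/mf. Qed.

Lemma G_measurable_comp G (f : T -> R) (g : R -> R) :
  measurable_fun setT g -> G_measurable G f -> G_measurable G (g \o f).
Proof.
move=> mg mf B mB; rewrite comp_preimage; apply: mf.
by rewrite -[X in measurable X]setTI; exact: mg.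
Qed.

(* Slicing [D] along the levels [k e <= h < (k + 1) e] costs only
   [e * \int_D U], which vanishes with [e]. *)
Lemma le_integral_mul_known (mu : {measure set T -> \bar R}) G
    (X U h : T -> R) D : Defs.sub_sigma_algebra G ->
  measurable_fun setT X -> measurable_fun setT U ->
  (forall x, 0 <= X x) -> (forall x, 0 <= U x) -> (forall x, 0 <= h x) ->
  G_measurable G h ->
  (forall A, G A ->
    (\int[mu]_(x in A) (X x)%:E <= \int[mu]_(x in A) (U x)%:E)%E) ->
  G D -> (\int[mu]_(x in D) (U x)%:E < +oo)%E ->
  (\int[mu]_(x in D) (h x * X x)%:E <= \int[mu]_(x in D) (h x * U x)%:E)%E.
Proof.
move=> sG mX mU X0 U0 h0 mh XU GD finU.
have mh' : measurable_fun setT h by exact: G_measurable_fun mh.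
have mG A : G A -> measurable A by case: sG => _; exact.
have mD := mG _ GD.
have I0 : (0 <= \int[mu]_(x in D) (U x)%:E)%E.
  by apply: integral_ge0 => x _; rewrite lee_fin.
pose I := fine (\int[mu]_(x in D) (U x)%:E)%E.
have IE : (\int[mu]_(x in D) (U x)%:E = I%:E)%E by rewrite fineK// ge0_fin_numE.
have I0' : 0 <= I by rewrite -lee_fin -IE.
(* The mesh [r] keeps the slicing error [r * I] at most [e]; the [+ 1] covers [I = 0]. *)
apply/lee_addgt0Pr => e e0; pose r := e / (I + 1).
have r0 : 0 < r by rewrite divr_gt0// ltr_wpDl.
have r0' := ltW r0.
pose S k := D `&` h @^-1` `[k%:R * r, k.+1%:R * r[.
have GS k : G (S k) by apply: sub_sigma_algebraI => //; exact: mh.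
have mS k : measurable (S k) := mG _ (GS k).
have inS k x : S k x -> k%:R * r <= h x < k.+1%:R * r.
  by case=> _ /=; rewrite in_itv.
have DS : D = \bigcup_k S k.
  apply/seteqP; split => [x Dx|x [k _ []]//].
  exists (Num.truncn (h x / r)) => //; split => //=.
  have /andP[] := truncn_itv (divr_ge0 (h0 x) (ltW r0)).
  by rewrite in_itv/= ler_pdivlMr// ltr_pdivrMr// => -> ->.
have tS : trivIset setT S.
  apply/trivIsetP => i j _ _ ij; apply/seteqP; split => // x.
  move=> [/inS/andP[a b] /inS/andP[c' d']].
  move: ij; rewrite neq_ltn => /orP[] ij.
  - have : h x < h x.
      apply: (lt_le_trans b); apply: le_trans c'.
      by rewrite ler_wpM2r ?ler_nat// ltW.
    by rewrite ltxx.
  - have : h x < h x.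
      apply: (lt_le_trans d'); apply: le_trans a.
      by rewrite ler_wpM2r ?ler_nat// ltW.
    by rewrite ltxx.
have split_int (f : T -> R) : measurable_fun setT f -> (forall x, 0 <= f x) ->
    (\int[mu]_(x in D) (f x)%:E = \sum_(0 <= k <oo) \int[mu]_(x in S k) (f x)%:E)%E.
  move=> mf f0; rewrite DS; apply: ge0_integral_bigcup => //.
    exact/measurable_EFinP/measurable_funTS.
  by move=> x _; rewrite lee_fin.
have mhX : measurable_fun setT (fun x => h x * X x) by exact: measurable_funM.
have mhU : measurable_fun setT (fun x => h x * U x) by exact: measurable_funM.
have mrU : measurable_fun setT (fun x => r * U x) by exact: measurable_funM.
apply: (@le_trans _ _ (\int[mu]_(x in D) (h x * U x + r * U x)%:E)%E).
  rewrite (split_int (fun x => h x * X x))//; last by move=> x; rewrite mulr_ge0.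
  rewrite split_int; last 2 first.
  - exact: measurable_funD.
  - by move=> x; rewrite addr_ge0// mulr_ge0.
  apply: lee_nneseries => [k _ _|k _].
    by apply: integral_ge0 => x _; rewrite lee_fin mulr_ge0.
  have kr0 : 0 <= k.+1%:R * r by rewrite mulr_ge0.
  (* On a slice [h] is replaced by its upper level, a constant. The slice lies in [G], so the
     hypothesis on [X] and [U] applies to it, and the level is at most [h + r]. *)
  apply: (@le_trans _ _ (\int[mu]_(x in S k) (k.+1%:R * r * X x)%:E)%E).
    apply: ge0_le_integral_EFin => // [|x|x /inS/andP[_ b]].
    - exact: measurable_funM.
    - by rewrite mulr_ge0.
    - by rewrite ler_wpM2r// ltW.
  rewrite ge0_integral_EFinZl//.
  apply: (le_trans (lee_wpmul2l _ (XU _ (GS k)))); first by rewrite lee_fin.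
  rewrite -ge0_integral_EFinZl//.
  apply: ge0_le_integral_EFin => // [||x|x /inS/andP[a _]].
  - exact: measurable_funM.
  - exact: measurable_funD.
  - by rewrite mulr_ge0.
  - rewrite -mulrDl ler_wpM2r// -natr1 mulrDl mul1r; lra.
rewrite ge0_integral_EFinD// => [|x|x]; last 2 first.
- by rewrite mulr_ge0.
- by rewrite mulr_ge0.
rewrite leeD2l// ge0_integral_EFinZl// IE -EFinM lee_fin /r.
by rewrite mulrAC ler_pdivrMr ?ltr_wpDl// ler_pM2l// lerDl.
Qed.

End sub_sigma_algebra.

(** * The one-step bound on the second moment of the excess over [c] *)

Section one_step.
Set Implicit Arguments.
Unset Strict Implicit.
Context d (Omega : measurableType d) (R : realType) (P : probability Omega R).

(** The derivative [2 max(x - c, 0)] of the squared positive part is 2-Lipschitz, so the first-order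
    expansion errs by at most [(x' - x)^2]. The cross terms are arranged so that for non-negative
    [x] and [x'] both sides are sums of non-negative terms, ready for extended-valued
    integration. *)
Lemma pospart_step (c b x x' : R) : `|x' - x| <= b ->
  Num.max (x' - c) 0 ^+ 2 + 2 * (Num.max (x - c) 0 * x) <=
  Num.max (x - c) 0 ^+ 2 + b ^+ 2 + 2 * (Num.max (x - c) 0 * x').
Proof.
move=> xx'; have b0 : 0 <= b := le_trans (normr_ge0 _) xx'.
have /andP[lo hi] : - b <= x' - x <= b by rewrite -ler_norml.
have [cx|xc] := leP 0 (x - c).
- apply: (@le_trans _ _ ((x' - c) ^+ 2 + 2 * ((x - c) * x))).
    by rewrite lerD2r; case: (leP 0 (x' - c)) => _ //; rewrite expr0n/= sqr_ge0.
  nra.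
- rewrite !mul0r mulr0 addr0 expr0n/= add0r addr0.
  case: (leP 0 (x' - c)) => ?; last by rewrite expr0n/= sqr_ge0.
  by rewrite lerXn2r ?nnegrE//; lra.
Qed.

(** [pospart_step] is integrated over [D]. The factor [h = max(z - c, 0)] is known at [G], so
    [le_integral_mul_known] inserts the drift bound in the cross term. As [c] is the zero of the
    drift [- alpha t (z - c)] and [h (z - c) = h^2], this yields the contraction [- 2 alpha t h^2];
    the squared increment bound gives the terms in [t^2]. *)
Lemma integral_sqr_pospart_step (G : set (set Omega)) (alpha xi B t : R)
    (z z' : Omega -> R) (D : set Omega) (c := xi / alpha) :
  Defs.sub_sigma_algebra G ->
  0 < alpha -> 0 < xi -> 0 < t -> 2 * alpha * t <= 1 ->
  (forall w, 0 <= z w) -> (forall w, 0 <= z' w) ->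
  G_measurable G z -> measurable_fun setT z' ->
  (exists Y : Omega -> \bar R, is_cond_exp P G z' Y /\
    {ae P, forall w, (Y w <= ((1 - alpha * t) * z w + xi * t)%:E)%E}) ->
  {ae P, forall w, `|z' w - z w| <= B * t * (z w + 1)} ->
  G D -> (\int[P]_(w in D) (Num.max (z w - c) 0 ^+ 2)%:E < +oo)%E ->
  (\int[P]_(w in D) (Num.max (z' w - c) 0 ^+ 2)%:E <=
   (1 - 2 * alpha * t + 2 * B ^+ 2 * t ^+ 2)%:E *
     \int[P]_(w in D) (Num.max (z w - c) 0 ^+ 2)%:E +
   (2 * B ^+ 2 * (c + 1) ^+ 2 * t ^+ 2)%:E * P D)%E.
Proof.
move=> sG al0 xi0 t0 alt z0 z'0 Gz mz' [Y [[mY [Y0 intY]] YU]] incr GD fin.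
have mG A : G A -> measurable A by case: sG => _; exact.
have mD := mG _ GD.
have c0 : 0 < c by rewrite divr_gt0.
have xiE : xi = alpha * c by rewrite /c mulrC divfK// gt_eqF.
clearbody c.
pose pos (x : R) := Num.max (x - c) 0.
have mpos : measurable_fun setT pos.
  by apply: measurable_maxr => //; exact: measurable_funB.
have pos0 x : 0 <= pos x by rewrite le_max lexx orbT.
have posle x : x <= pos x + c by rewrite -lerBlDr le_max lexx.
have posM x : pos x * (x - c) = pos x ^+ 2.
  by rewrite /pos; case: (leP 0 (x - c)) => _ //; rewrite mul0r expr0n.
have mz : measurable_fun setT z := G_measurable_fun sG Gz.
pose h := pos \o z; pose h' := pos \o z'.
have mh : measurable_fun setT h by exact: measurableT_comp.
have mh' : measurable_fun setT h' by exact: measurableT_comp.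
have h0 w : 0 <= h w := pos0 _.
have mh2 : measurable_fun setT (fun w => h w ^+ 2) by exact: measurable_funX.
have mh'2 : measurable_fun setT (fun w => h' w ^+ 2) by exact: measurable_funX.
(* Since [P] is finite, domination by an affine function of [h^2] suffices for a finite integral
   over [D]. *)
have fin_dom (a b : R) (f : Omega -> R) : 0 <= a -> 0 <= b ->
    measurable_fun setT f -> (forall w, 0 <= f w) ->
    (forall w, f w <= a * h w ^+ 2 + b) -> (\int[P]_(w in D) (f w)%:E < +oo)%E.
  move=> a0 b0 mf f0 fab.
  have mah : measurable_fun setT (fun w => a * h w ^+ 2) by exact: measurable_funM.
  apply: (@le_lt_trans _ _ (\int[P]_(w in D) (a * h w ^+ 2 + b)%:E)%E).
    apply: ge0_le_integral_EFin => //; exact: measurable_funD.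
  rewrite ge0_integral_EFinD//; last by move=> w; rewrite mulr_ge0// sqr_ge0.
  rewrite ge0_integral_EFinZl//; last by move=> w; rewrite sqr_ge0.
  rewrite (integral_cst _ mD b%:E) lte_add_pinfty//.
    by rewrite lte_mul_pinfty// lee_fin.
  by rewrite lte_mul_pinfty// ?lee_fin// (le_lt_trans (probability_le1 _ mD))// ltry.
pose U w := (1 - alpha * t) * z w + xi * t.
have alt1 : 0 <= 1 - alpha * t by nra.
have U0 w : 0 <= U w by rewrite addr_ge0// mulr_ge0// ltW.
have mU : measurable_fun setT U.
  by apply: measurable_funD => //; exact: measurable_funM.
have finU : (\int[P]_(w in D) (U w)%:E < +oo)%E.
  apply: (@fin_dom 1 (1 + c + xi * t)) => // [|w].
    by rewrite addr_ge0 ?mulr_ge0 ?addr_ge0// ltW.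
  have zh : z w <= h w + c := posle _; rewrite /U.
  have : 0 <= alpha * t * z w by rewrite !mulr_ge0// ltW.
  have := sqr_ge0 (h w); have := sqr_ge0 (h w - 1); rewrite sqrrB; lra.
(* The defining identity of the conditional expectation turns the almost sure drift bound into a
   bound on each event of [G]. *)
have XU A : G A ->
    (\int[P]_(w in A) (z' w)%:E <= \int[P]_(w in A) (U w)%:E)%E.
  move=> GA; rewrite (intY _ GA); apply: ae_ge0_le_integral => //.
  - exact: mG.
  - exact/measurable_funTS/(G_emeasurable_fun sG).
  - by move=> w _; rewrite lee_fin.
  - exact/measurable_EFinP/measurable_funTS.
  - by apply: filterS YU => w + _.
have Gh : G_measurable G h by exact: G_measurable_comp.
have hXU := le_integral_mul_known sG mz' mU z'0 U0 h0 Gh XU GD finU.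
pose K w := h w ^+ 2 + (B * t * (z w + 1)) ^+ 2.
have mK : measurable_fun setT K.
  apply: measurable_funD => //; apply: measurable_funX.
  by apply: measurable_funM => //; exact: measurable_funD.
have K0 w : 0 <= K w by rewrite addr_ge0 ?sqr_ge0.
have m2h (f : Omega -> R) : measurable_fun setT f ->
    measurable_fun setT (fun w => 2 * (h w * f w)).
  by move=> mf; do 2 apply: measurable_funM => //.
have m1h (f : Omega -> R) : measurable_fun setT f ->
    measurable_fun setT (fun w => h w * f w).
  by move=> mf; apply: measurable_funM.
have p2h (f : Omega -> R) : (forall w, 0 <= f w) -> forall w, 0 <= 2 * (h w * f w).
  by move=> f0 w; rewrite !mulr_ge0.
have p1h (f : Omega -> R) : (forall w, 0 <= f w) -> forall w, 0 <= h w * f w.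
  by move=> f0 w; rewrite !mulr_ge0.
pose q := 1 - 2 * alpha * t + 2 * B ^+ 2 * t ^+ 2.
pose E := 2 * B ^+ 2 * (c + 1) ^+ 2 * t ^+ 2.
have Bt0 := mulr_ge0 (sqr_ge0 B) (sqr_ge0 t).
have q0 : 0 <= q by rewrite /q; lra.
have E0 : 0 <= E by have := mulr_ge0 Bt0 (sqr_ge0 (c + 1)); rewrite /E; lra.
have finhz : (\int[P]_(w in D) (2 * (h w * z w))%:E)%E \is a fin_num.
  rewrite ge0_fin_numE; last by apply: integral_ge0 => w _; rewrite lee_fin p2h.
  apply: (@fin_dom 3 (c ^+ 2)) => //.
  - exact: sqr_ge0.
  - exact: m2h.
  - exact: p2h.
  - move=> w; have zh : z w <= h w + c := posle _.
    have := ler_wpM2l (h0 w) zh; have := sqr_ge0 (h w - c).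
    rewrite sqrrB mulrDr -expr2; lra.
(* Adding the finite integral of [2 h z] to both sides produces the left-hand side of [pospart_step]
   without any subtraction. *)
rewrite -(leeD2rE _ _ finhz).
have mqh : measurable_fun setT (fun w => q * h w ^+ 2) by exact: measurable_funM.
have pqh w : 0 <= q * h w ^+ 2 by rewrite mulr_ge0// sqr_ge0.
rewrite -ge0_integral_EFinD//; [|exact: m2h|by move=> w; exact: sqr_ge0|exact: p2h].
apply: (@le_trans _ _ (\int[P]_(w in D) (K w + 2 * (h w * z' w))%:E)%E).
  apply: ae_ge0_le_integral => //.
  - by move=> w _; rewrite lee_fin addr_ge0 ?sqr_ge0// p2h.
  - by apply/measurable_EFinP/measurable_funTS/measurable_funD => //; exact: m2h.
  - by move=> w _; rewrite lee_fin addr_ge0// p2h.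
  - by apply/measurable_EFinP/measurable_funTS/measurable_funD => //; exact: m2h.
  - by apply: filterS incr => w zz _; rewrite lee_fin; exact: pospart_step.
rewrite ge0_integral_EFinD//; [|exact: m2h|exact: p2h].
rewrite ge0_integral_EFinZl//; [|exact: m1h|exact: p1h].
apply: (le_trans (leeD2l _ (lee_wpmul2l _ hXU))) => //.
rewrite -ge0_integral_EFinZl//; [|exact: m1h|exact: p1h].
rewrite -ge0_integral_EFinD//; [|exact: m2h|exact: p2h].
rewrite -/q -/E -(integral_cst _ mD E%:E) -ge0_integral_EFinZl//; last first.
  by move=> w; exact: sqr_ge0.
rewrite -ge0_integral_EFinD//.
rewrite -ge0_integral_EFinD//;
  [|exact: measurable_funD|exact: m2h| |exact: p2h]; last first.
  by move=> w; apply: addr_ge0; [exact: pqh|exact: E0].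
apply: ge0_le_integral_EFin => //.
- by apply: measurable_funD => //; exact: m2h.
- by apply: measurable_funD; [exact: measurable_funD|exact: m2h].
- by move=> w; rewrite addr_ge0// p2h.
- move=> w _; have := z0 w.
  have : h w * (z w - c) = h w ^+ 2 := posM _.
  have : z w <= h w + c := posle _.
  rewrite -[Num.max _ _]/(h w) /K /U /q /E xiE.
  move: (h w) (z w) (h0 w) => y x y0 xy yx x0.
  have -> : 2 * (y * ((1 - alpha * t) * x + alpha * c * t)) =
      2 * (y * x) - 2 * alpha * t * y ^+ 2 by rewrite -yx; ring.
  (* From [x + 1 <= y + (c + 1)] and [(u + v)^2 <= 2 u^2 + 2 v^2]; this is the source of the factors
     2 in the [t^2] terms of [q] and [E]. *)
  have : (x + 1) ^+ 2 <= 2 * y ^+ 2 + 2 * (c + 1) ^+ 2.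
    have := sqr_ge0 (y - (c + 1)); nra.
  move/(ler_wpM2l (mulr_ge0 (sqr_ge0 B) (sqr_ge0 t))) => le1.
  have -> : (B * t * (x + 1)) ^+ 2 = B ^+ 2 * t ^+ 2 * (x + 1) ^+ 2 by ring.
  rewrite -subr_ge0; move: le1; rewrite -subr_ge0.
  by congr (0 <= _); ring.
Qed.

End one_step.

(** * Almost supermartingales: decay in mean, maximal inequality, almost sure limit *)

Section almost_supermartingale.
Set Implicit Arguments.
Unset Strict Implicit.
Context d (Omega : measurableType d) (R : realType) (P : probability Omega R).
Variables (F : nat -> set (set Omega)) (W : nat -> Omega -> R).
Variables (b p : nat -> R) (N : nat) (A : set Omega).
Hypothesis filF : filtration F.
Hypothesis W0 : forall n w, 0 <= W n w.
Hypothesis FW : forall n, G_measurable (F n) (W n).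
Hypothesis b0 : forall n, 0 <= b n.
Hypothesis p0 : forall n, (N <= n)%N -> 0 < p n.
Hypothesis p_nd : forall n, (N <= n)%N -> p n <= p n.+1.
Hypothesis FA : F N A.
Hypothesis finA : (\int[P]_(w in A) (W N w)%:E < +oo)%E.
Hypothesis step : forall n G, (N <= n)%N -> F n G -> G `<=` A ->
  (\int[P]_(w in G) (W n w)%:E < +oo)%E ->
  (\int[P]_(w in G) (W n.+1 w)%:E <=
   (p n / p n.+1)%:E * \int[P]_(w in G) (W n w)%:E + (b n)%:E)%E.

Let mF n G : F n G -> measurable G.
Proof. by case: filF => /(_ n)[_ +] _; exact. Qed.

Let F_mono m n : (m <= n)%N -> F m `<=` F n.
Proof.
move=> /subnK <-; elim: (n - m)%N => [|k IH]//=.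
by apply: subset_trans IH _; rewrite addSn; case: filF.
Qed.

Let mW n : measurable_fun setT (W n).
Proof. by apply: G_measurable_fun (FW n); case: filF. Qed.

Let int_ge0 n G : (0 <= \int[P]_(w in G) (W n w)%:E)%E.
Proof. by apply: integral_ge0 => w _; rewrite lee_fin. Qed.

Let int_subset n G H : measurable G -> measurable H -> G `<=` H ->
  (\int[P]_(w in G) (W n w)%:E <= \int[P]_(w in H) (W n w)%:E)%E.
Proof.
move=> mG mH; apply: ge0_subset_integral => //.
  exact/measurable_EFinP/measurable_funTS.
by move=> w _; rewrite lee_fin.
Qed.

Let mA : measurable A. Proof. exact: mF FA. Qed.

Lemma expectation_lty n : (N <= n)%N -> (\int[P]_(w in A) (W n w)%:E < +oo)%E.
Proof.
move=> /subnK <-; elim: (n - N)%N => [|k IH]//; rewrite addSn.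
have Nk : (N <= k + N)%N by rewrite leq_addl.
apply: le_lt_trans (step Nk (F_mono Nk FA) (@subset_refl _ A) IH) _.
rewrite lte_add_pinfty ?ltry// lte_mul_pinfty// lee_fin divr_ge0// ltW// p0//.
exact: leqW.
Qed.

Let I n := fine (\int[P]_(w in A) (W n w)%:E)%E.

Let IE n : (N <= n)%N -> (\int[P]_(w in A) (W n w)%:E = (I n)%:E)%E.
Proof. by move=> Nn; rewrite fineK// ge0_fin_numE// expectation_lty. Qed.

(** The ratios [p n / p n.+1] telescope, and each is at most 1, so the accumulated noise [b] is
    never amplified. *)
Lemma expectation_decay m k : (N <= m)%N ->
  I (k + m) <= p m / p (k + m)%N * I m + \sum_(m <= i < k + m) b i.
Proof.
move=> Nm; elim: k => [|k IH].
  by rewrite add0n big_geq// addr0 divff ?mul1r// gt_eqF// p0.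
have Nk : (N <= k + m)%N by rewrite (leq_trans Nm)// leq_addl.
have Nk1 : (N <= (k + m).+1)%N by exact: leqW.
have := step Nk (F_mono Nk FA) (@subset_refl _ A) (expectation_lty Nk).
rewrite addSn !IE// -EFinM -EFinD lee_fin => /le_trans; apply.
rewrite big_nat_recr ?leq_addl//= addrA lerD2r.
have r0 : 0 <= p (k + m)%N / p (k + m).+1 by rewrite divr_ge0// ltW// p0.
have r1 : p (k + m)%N / p (k + m).+1 <= 1.
  by rewrite ler_pdivrMr ?p0// mul1r p_nd.
apply: le_trans (ler_wpM2l r0 IH) _; rewrite mulrDr lerD//.
  suff -> : p (k + m)%N / p (k + m).+1 * (p m / p (k + m)%N * I m) =
    p m / p (k + m).+1 * I m by [].
  by field; rewrite !gt_eqF// p0.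
by rewrite ler_piMl// sumr_ge0.
Qed.

(** Stage [j] tests the times [m] to [m + j - 1] only. Stage [j + 1] is therefore already known at
    time [m + j], where [step] can be applied on it. *)
Fixpoint stay_below (lam : R) (m j : nat) : set Omega :=
  if j is j'.+1 then stay_below lam m j' `&` W (m + j') @^-1` `]-oo, lam[
  else A.

Let F_stay_below lam m j : (N <= m)%N -> F (m + j) (stay_below lam m j).
Proof.
move=> Nm; elim: j => [|j IH] /=; first by rewrite addn0; exact: F_mono FA.
rewrite addnS; case: filF => sF; apply.
by apply: sub_sigma_algebraI => //; exact: FW.
Qed.

Let F_stay_belowS lam m j : (N <= m)%N -> F (m + j) (stay_below lam m j.+1).
Proof.
move=> Nm; case: filF => sF _.
by apply: sub_sigma_algebraI => //; [exact: F_stay_below|exact: FW].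
Qed.

Let stay_below_sub lam m j : stay_below lam m j `<=` A.
Proof. by elim: j => [//|j IH] w [/IH]. Qed.

(** Doob's stopping argument by induction on [j]: paths that have reached [lam] are stopped and
    charged [lam], while the others move one step at the cost of one more [b]. *)
Lemma maximal_ineq_fin (lam : R) m j : (N <= m)%N -> 0 < lam ->
  (lam%:E * P (A `\` stay_below lam m j) +
    \int[P]_(w in stay_below lam m j) (W (m + j) w)%:E <=
  \int[P]_(w in A) (W m w)%:E + (\sum_(m <= i < m + j) b i)%:E)%E.
Proof.
move=> Nm lam0; elim: j => [|j IH].
  by rewrite /= setDv measure0 mule0 add0e addn0 big_geq// adde0.
set n := (m + j)%N in IH *; rewrite addnS -/n.
have Nn : (N <= n)%N by rewrite (leq_trans Nm)// leq_addr.
have mn : (m <= n)%N by exact: leq_addr.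
set D := stay_below lam m j in IH *; set D' := stay_below lam m j.+1.
have mD : measurable D by exact: mF (F_stay_below _ _ Nm).
have mD' : measurable D' by exact: mF (F_stay_belowS _ _ Nm).
have D'D : D' `<=` D by move=> w [].
have DA : D `<=` A by exact: stay_below_sub.
have finD' : (\int[P]_(w in D') (W n w)%:E < +oo)%E.
  apply: le_lt_trans (expectation_lty Nn); apply: int_subset => //.
  exact: subset_trans D'D DA.
have r1 : p n / p n.+1 <= 1 by rewrite ler_pdivrMr ?mul1r ?p_nd// p0// leqW.
have stepD' : (\int[P]_(w in D') (W n.+1 w)%:E <=
    \int[P]_(w in D') (W n w)%:E + (b n)%:E)%E.
  have := step Nn (F_stay_belowS lam j Nm) (subset_trans D'D DA) finD'.
  move=> /le_trans; apply; rewrite leeD2r//.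
  by rewrite -[leRHS]mul1e lee_wpmul2r.
(* Paths leaving at time [n] have [W n >= lam], so their share of the integral pays the charge. *)
have Wlam : (lam%:E * P (D `\` D') <= \int[P]_(w in D `\` D') (W n w)%:E)%E.
  rewrite -integral_cst; last exact: measurableD.
  apply: (@ge0_le_integral_EFin _ _ _ _ _ (fun=> lam)) => //.
  - exact: measurableD.
  - by move=> _; exact: ltW.
  - move=> w [Dw D'w]; rewrite leNgt; apply/negP => Wl; apply: D'w; split => //=.
have intD : (\int[P]_(w in D) (W n w)%:E =
    \int[P]_(w in D') (W n w)%:E + \int[P]_(w in D `\` D') (W n w)%:E)%E.
  rewrite -{1}(setDUK D'D) ge0_integral_setU//.
  - exact: measurableD.
  - by apply/measurable_EFinP/measurable_funTS.
  - by move=> w _; rewrite lee_fin.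
  - by apply/disj_setPS => w [? []].
have PA : P (A `\` D') = (P (A `\` D) + P (D `\` D'))%E.
  have -> : A `\` D' = (A `\` D) `|` (D `\` D').
    apply/seteqP; split => [w [Aw D'w]|w [[Aw Dw]|[Dw D'w]]].
    - by have [Dw|Dw] := pselect (D w); [right|left].
    - by split => // /D'D.
    - by split => //; exact: DA.
  rewrite measureU//; [exact: measurableD|exact: measurableD|].
  by apply/seteqP; split => // w [[_ ?] []].
rewrite PA big_nat_recr//= EFinD ge0_muleDr// [leRHS]addeA.
apply: (le_trans _ (leeD2r (b n)%:E IH)); rewrite intD.
move: stepD' Wlam (int_ge0 n D') (int_ge0 n (D `\` D')).
move: (\int[P]_(w in D') (W n.+1 w)%:E)%E => x.
move: (\int[P]_(w in D') (W n w)%:E)%E => y.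
move: (\int[P]_(w in D `\` D') (W n w)%:E)%E => u xy lu y0 u0.
apply: (le_trans (leeD2l _ xy)).
by rewrite addeA leeD2r// -!addeA leeD2l// addeC leeD2l.
Qed.

Lemma maximal_ineq (lam e : R) m : (N <= m)%N -> 0 < lam ->
  (forall n, \sum_(m <= i < n) b i <= e) ->
  (lam%:E * P (\bigcup_j (A `\` stay_below lam m j)) <= (I m + e)%:E)%E.
Proof.
move=> Nm lam0 be.
have mj j : measurable (A `\` stay_below lam m j).
  by apply: measurableD => //; exact: mF (F_stay_below _ _ Nm).
have nd : nondecreasing_seq (fun j => A `\` stay_below lam m j).
  apply/nondecreasing_seqP => j; apply/subsetPset => w [Aw Dw]; split => //.
  by case.
have cvP := @nondecreasing_cvg_mu _ _ _ P _ mj (bigcupT_measurable _ mj) nd.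
have cP := cvP; move/cvgP in cP.
rewrite -(cvg_lim _ cvP)// -limeMl//.
apply: lime_le; first by apply: is_cvgeMl.
apply: nearW => j /=.
have := @maximal_ineq_fin lam m j Nm lam0; rewrite IE// -EFinD => h.
apply: le_trans (le_trans h _); first by rewrite leeDl.
by rewrite lee_fin lerD2l.
Qed.

(** A bad path reaches [lam] after every starting time, so [maximal_ineq] from a single late start
    bounds the probability. There the mean is small by [expectation_decay] and the remaining noise
    is a series tail. *)
Lemma ae_limsup_lt (lam : R) : cvgn (series b) -> p @ \oo --> +oo -> 0 < lam ->
  P.-negligible
    (A `&` [set w | forall m, exists2 k, (m <= k)%N & lam <= W k w]).
Proof.
move=> cb cp lam0; set Bad := A `&` _.
pose U m := \bigcup_j (A `\` stay_below lam m j).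
have BadU m : Bad `<=` U m.
  (* The successor is needed for the stage to include the test at time [k] itself. *)
  move=> w [Aw /(_ m)[k mk lamk]]; exists (k - m).+1 => //; split => //= -[_ /=].
  by rewrite subnKC// in_itv/= ltNge lamk.
have mU m : (N <= m)%N -> measurable (U m).
  move=> Nm; apply: bigcupT_measurable => j; apply: measurableD => //.
  exact: mF (F_stay_below _ _ Nm).
have mUN : measurable (\bigcap_m U (m + N)%N).
  by apply: bigcapT_measurable => m; apply: mU; exact: leq_addl.
exists (\bigcap_m U (m + N)%N); split => //; last by move=> w Bw m _; exact: BadU.
apply/eqP; rewrite eq_le measure_ge0 andbT; apply/lee_addgt0Pr => e e0.
(* One third each for the decayed mean from time [m], the noise between [m] and [n], and the noise
   after [n]. *)
rewrite add0e; pose e' := lam * e / 3.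
have e'0 : 0 < e' by rewrite divr_gt0// mulr_gt0.
have [M _ hM] := cvgn_series_tail b0 cb e'0.
pose m := maxn M N.
have Nm : (N <= m)%N by rewrite leq_maxr.
have tail n : \sum_(m <= i < n) b i <= e' by apply: hM; rewrite /= leq_maxl.
(* With [m] fixed, [n] is taken so late that [p m / p n * I m <= e']. *)
have /cvgryPge/(_ (p m * I m / e'))[K _ hK] := cp.
pose n := (K + m)%N.
have Nn : (N <= n)%N by rewrite (leq_trans Nm)// leq_addl.
have tailn k : \sum_(n <= i < k) b i <= e'.
  by apply: hM => /=; rewrite (leq_trans (leq_maxl M N))// leq_addl.
have In : I n <= e' + e'.
  apply: (le_trans (expectation_decay K Nm)); apply: lerD => //.
  rewrite mulrAC ler_pdivrMr ?p0// [leRHS]mulrC -ler_pdivrMr//.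
  by apply: hK; rewrite /= leq_addr.
have PU : (P (\bigcap_m U (m + N)%N) <= P (U n))%E.
  apply: le_measure; rewrite ?inE//; first exact: mU.
  by move=> w /(_ (n - N)%N Logic.I); rewrite subnK.
apply: (le_trans PU).
have := maximal_ineq Nn lam0 tailn.
rewrite -lee_pdivlMl// => /le_trans; apply.
rewrite -EFinM lee_fin mulrC ler_pdivrMr//.
rewrite (_ : e * lam = e' + e' + e') ?lerD2r// /e'; lra.
Qed.

End almost_supermartingale.

(** * Polynomial contraction rate and smallness of the step sizes *)

Section polynomial_rate.
Set Implicit Arguments.
Unset Strict Implicit.
Variable R : realType.

(** Because [n t >= L], the factor is at most [1 - (2 alpha - 2 B^2 t) L / n]. The quadratic term
    uses at most [2 del] of the surplus [3 del], which leaves the exponent [eta + del] for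
    [powR_natS_le]. *)
Lemma contraction_rate (alpha B L eta del t : R) (n : nat) : (0 < n)%N ->
  0 < eta -> 0 < del -> 0 < t -> 0 < L -> 2 * alpha * L = eta + 3 * del ->
  L <= n%:R * t -> B ^+ 2 * t * L <= del ->
  n.+1%:R `^ eta * (1 - 2 * alpha * t + 2 * B ^+ 2 * t ^+ 2) <=
  n%:R `^ del / n.+1%:R `^ del * n%:R `^ eta.
Proof.
move=> n0 eta0 del0 t0 L0 aL nt Bt.
have nR : (0 : R) < n%:R by rewrite ltr0n.
have s0 : 0 <= eta + del by rewrite addr_ge0// ltW.
have q_le : 1 - 2 * alpha * t + 2 * B ^+ 2 * t ^+ 2 <= 1 - (eta + del) / n%:R.
  suff : (eta + del) / n%:R <= t * (2 * alpha - 2 * (B ^+ 2 * t)).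
    by rewrite [B ^+ 2 * t]mulrC; lra.
  rewrite ler_pdivrMr//.
  have kL : eta + del <= (2 * alpha - 2 * (B ^+ 2 * t)) * L by lra.
  have k0 : 0 <= 2 * alpha - 2 * (B ^+ 2 * t).
    by rewrite -(pmulr_lge0 _ L0) (le_trans s0).
  apply: (le_trans kL); move: (2 * alpha - _) k0 => k k0.
  by rewrite (mulrC t) -mulrA (mulrC t) ler_wpM2l.
apply: (le_trans (ler_wpM2l (powR_ge0 _ _) q_le)).
rewrite mulrAC ler_pdivlMr ?powR_gt0// mulrAC -powRD; last first.
  by rewrite pnatr_eq0/= implybT.
rewrite [leRHS]mulrC -powRD; last by rewrite (gt_eqF nR)/= implybT.
exact: powR_natS_le.
Qed.

Lemma cvgn_series_sqr_le (u : nat -> R) (e : R) : 0 < e ->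
  (forall n, 0 <= u n) -> cvgn (series (fun n => u n ^+ 2)) ->
  \forall n \near \oo, u n <= e.
Proof.
move=> e0 u0 /cvg_series_cvg_0/cvgr0Pnorm_lt/(_ _ (exprn_gt0 2 e0))[N _ hN].
exists N => // n /hN /=; rewrite ger0_norm ?sqr_ge0//.
by rewrite ltr_pXn2r ?nnegrE ?(ltW e0)// => /ltW.
Qed.

Lemma cvg_powR_nat (s : R) : 0 < s -> (fun n => n%:R `^ s) @ \oo --> +oo.
Proof.
move=> s0; apply/cvgryPge => K.
have [N _ hN] := nbhs_infty_ger (Num.max K 1 `^ s^-1).
exists N => // n /hN /= nK.
apply: (@le_trans _ _ (Num.max K 1)); first by rewrite le_max lexx.
have M0 : 0 <= Num.max K 1 by rewrite le_max ler01 orbT.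
rewrite -[leLHS]powRr1// -[X in _ `^ X](mulVf (lt0r_neq0 s0)) powRrM.
by apply: (ge0_ler_powR (ltW s0)); rewrite ?nnegrE ?powR_ge0.
Qed.

End polynomial_rate.

(** * Almost sure convergence of the scaled distance *)

Theorem theorem3 (d : measure_display) (Omega : measurableType d) (R : realType)
  (P : probability Omega R) (F : nat -> set (set Omega))
  (alpha xi B1 eta : R) (T : nat -> R) (z : nat -> Omega -> R) :
  filtration F ->
  0 < alpha -> 0 < xi ->
  (forall n, 0 < T n < 1) ->
  (forall n, T n.+1 < T n) ->
  (\sum_(0 <= k <oo) (T k)%:E = +oo)%E ->
  (\sum_(0 <= k <oo) ((T k) ^+ 2)%:E < +oo)%E ->
  (forall n w, 0 <= z n w) ->
  (forall n, G_measurable (F n) (z n)) ->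
  (forall n, exists Y : Omega -> \bar R,
      is_cond_exp P (F n) (z n.+1) Y /\
      {ae P, forall w, (Y w <= ((1 - alpha * T n) * z n w + xi * T n)%:E)%E}) ->
  alpha <= B1 ->
  (forall n, {ae P, forall w, `|z n.+1 w - z n w| <= B1 * T n * (z n w + 1)}) ->
  0 < eta ->
  ((eta / (2 * alpha))%:E < limn_einf (fun n => (n%:R * T n)%:E))%E ->
  (\sum_(0 <= k <oo) ((k.+1%:R `^ eta) * (T k) ^+ 2)%:E < +oo)%E ->
  {ae P, forall w,
     (fun n : nat => (n%:R `^ (eta / 2)) * dist_set (z n w) `[0, xi / alpha])
       @ \oo --> 0}.
Proof.
move=> filF al0 xi0 T01 _ _ sumT2 z0 Fz condz alB incr eta0 infT sumA2.
pose c := xi / alpha; have c0 : 0 < c by rewrite divr_gt0.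
have T0 n : 0 < T n by have /andP[] := T01 n.
have B0 : 0 < B1 by exact: lt_le_trans alB.
have a2 : 0 < 2 * alpha by rewrite mulr_gt0.
have [L etaL [N1 _ hN1]] := limn_einf_gt infT.
have L0 : 0 < L by rewrite (lt_trans _ etaL)// divr_gt0.
(* A third of the surplus given by (A1): two thirds absorb the quadratic term and one remains as the
   decay exponent. *)
pose del := (2 * alpha * L - eta) / 3.
have del0 : 0 < del.
  by rewrite divr_gt0// subr_gt0; move: etaL; rewrite ltr_pdivrMr// mulrC.
have aL : 2 * alpha * L = eta + 3 * del by rewrite /del; lra.
have cT2 := nneseries_EFin_cvgn (fun n => sqr_ge0 (T n)) sumT2.
(* This threshold on [T n] is the smallness that [contraction_rate] asks for; the later one,
   [1 / (2 alpha)], keeps the one-step factor non-negative. *)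
have tau0 : 0 < del / (B1 ^+ 2 * L) by rewrite divr_gt0// mulr_gt0// exprn_gt0.
have T0' n : 0 <= T n := ltW (T0 n).
have [N2 _ hN2] := cvgn_series_sqr_le tau0 T0' cT2.
have ia0 : 0 < (2 * alpha)^-1 by rewrite invr_gt0.
have [N3 _ hN3] := cvgn_series_sqr_le ia0 T0' cT2.
(* The leading 1 forces [n >= 1], hence positive powers of [n]. *)
pose N := (1 + N1 + N2 + N3)%N.
pose y n w := Num.max (z n w - c) 0.
pose W n w := n%:R `^ eta * y n w ^+ 2.
pose E := 2 * B1 ^+ 2 * (c + 1) ^+ 2.
have E0 : 0 <= E by have := mulr_ge0 (sqr_ge0 B1) (sqr_ge0 (c + 1)); rewrite /E; lra.
(* Passing from [k] to [k + 1] weights the noise by [(k + 1)^eta], the summand of (A2). *)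
pose a k := k.+1%:R `^ eta * T k ^+ 2.
have a0 k : 0 <= a k by rewrite mulr_ge0 ?powR_ge0 ?sqr_ge0.
pose b k := E * a k.
have b0 k : 0 <= b k by rewrite mulr_ge0.
have cb : cvgn (series b).
  exact: (is_cvg_seriesZ (nneseries_EFin_cvgn a0 sumA2)).
pose p n : R := n%:R `^ del.
have W0 n w : 0 <= W n w by rewrite mulr_ge0 ?powR_ge0 ?sqr_ge0.
have mpos : measurable_fun setT (fun x : R => Num.max (x - c) 0).
  by apply: measurable_maxr => //; exact: measurable_funB.
have FW n : G_measurable (F n) (W n).
  apply: (@G_measurable_comp _ _ _ _ (z n)
    (fun x => n%:R `^ eta * Num.max (x - c) 0 ^+ 2)) => //.
  by apply: measurable_funM => //; exact: measurable_funX.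
have mz n : measurable_fun setT (z n).
  by apply: G_measurable_fun (Fz n); case: filF.
have my2 n : measurable_fun setT (fun w => y n w ^+ 2).
  by apply: measurable_funX; exact: measurableT_comp mpos (mz n).
have intW n G : measurable G ->
    (\int[P]_(w in G) (W n w)%:E =
     (n%:R `^ eta)%:E * \int[P]_(w in G) (y n w ^+ 2)%:E)%E.
  move=> mG; apply: ge0_integral_EFinZl => //.
  by move=> w; exact: sqr_ge0.
have p0 n : (N <= n)%N -> 0 < p n.
  by move=> Nn; rewrite powR_gt0// ltr0n (leq_trans _ Nn).
have p_nd n : (N <= n)%N -> p n <= p n.+1.
  by move=> _; rewrite ge0_ler_powR ?nnegrE// ?ler_nat// ltW.
have step n G : (N <= n)%N -> F n G ->
    (\int[P]_(w in G) (W n w)%:E < +oo)%E ->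
    (\int[P]_(w in G) (W n.+1 w)%:E <=
     (p n / p n.+1)%:E * \int[P]_(w in G) (W n w)%:E + (b n)%:E)%E.
  move=> Nn FG; have [sF _] := filF.
  have mG : measurable G by case: (sF n) => _; exact.
  have n0 : (0 < n)%N by rewrite (leq_trans _ Nn).
  have nR : (0 : R) < n%:R by rewrite ltr0n.
  rewrite !intW// => fin.
  have I0 : (0 <= \int[P]_(w in G) (y n w ^+ 2)%:E)%E.
    by apply: integral_ge0 => w _; rewrite lee_fin sqr_ge0.
  have fin' : (\int[P]_(w in G) (y n w ^+ 2)%:E < +oo)%E.
    rewrite lt_neqAle leey andbT; apply/eqP => h; move: fin.
    by rewrite h gt0_muley// lte_fin powR_gt0.
  have Tsmall : 2 * alpha * T n <= 1.
    rewrite mulrC -ler_pdivlMr// mul1r; apply: hN3 => /=.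
    by apply: leq_trans Nn; rewrite leq_addl.
  have nT : L <= n%:R * T n.
    apply: hN1 => /=; apply: leq_trans Nn.
    by rewrite /N -addnA addnAC leq_addl.
  have BT : B1 ^+ 2 * T n * L <= del.
    rewrite mulrAC mulrC -ler_pdivlMr ?mulr_gt0 ?exprn_gt0//; apply: hN2 => /=.
    by apply: leq_trans Nn; rewrite /N addnAC leq_addl.
  have h := @integral_sqr_pospart_step _ _ _ P (F n) alpha xi B1 (T n)
    (z n) (z n.+1) G (sF n) al0 xi0 (T0 n) Tsmall (z0 n) (z0 n.+1) (Fz n)
    (mz n.+1) (condz n) (incr n) FG fin'.
  have PG : (P G <= 1)%E by exact: probability_le1.
  apply: (le_trans (lee_wpmul2l _ h)); first by rewrite lee_fin powR_ge0.
  rewrite ge0_muleDr//; last 2 first.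
  - apply: mule_ge0 => //; rewrite lee_fin.
    by have := mulr_ge0 (sqr_ge0 B1) (sqr_ge0 (T n)); lra.
  - by apply: mule_ge0 => //; rewrite lee_fin mulr_ge0 ?sqr_ge0.
  rewrite !muleA -!EFinM; apply: leeD.
    apply: lee_wpmul2r => //; rewrite lee_fin.
    exact: (@contraction_rate _ _ _ L).
  apply: (le_trans (lee_wpmul2l _ PG)).
    by rewrite lee_fin mulr_ge0 ?powR_ge0// mulr_ge0 ?sqr_ge0.
  by rewrite mule1 lee_fin mulrCA.
have cp : p @ \oo --> +oo by exact: cvg_powR_nat.
(* Truncation makes [W N] integrable on an event of [F N]; over all [M] these events cover the
   space. *)
pose A M := z N @^-1` `]-oo, M%:R].
have FA M : F N (A M) by exact: Fz.
have finA M : (\int[P]_(w in A M) (W N w)%:E < +oo)%E.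
  have mA : measurable (A M) by case: filF => /(_ N)[_ +] _; apply.
  apply: (@le_lt_trans _ _ (\int[P]_(w in A M) (N%:R `^ eta * M%:R ^+ 2)%:E)%E).
    apply: ge0_le_integral_EFin => //.
      by apply: measurable_funM.
    move=> w; rewrite /A /= in_itv/= => zM.
    rewrite ler_wpM2l ?powR_ge0// lerXn2r ?nnegrE ?le_max ?lexx ?orbT//.
    by rewrite ge_max ler0n andbT lerBlDr (le_trans zM)// lerDl ltW.
  rewrite (integral_cst _ mA (N%:R `^ eta * M%:R ^+ 2)%:E) lte_mul_pinfty//.
  by rewrite (le_lt_trans (probability_le1 _ mA))// ltry.
(* Countably many truncations [M] and levels [1 / (j + 1)], so one null set serves them all. *)
have bad M j : {ae P, forall w,
    ~ (A M `&` [set w | forall m, exists2 k, (m <= k)%N & j.+1%:R^-1 <= W k w]) w}.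
  have j0 : 0 < j.+1%:R^-1 :> R by rewrite invr_gt0.
  have := ae_limsup_lt filF W0 FW b0 p0 p_nd (FA M) (finA M)
    (fun n G Nn FG _ => step n G Nn FG) cb cp j0.
  apply: negligibleS => w /=.
  exact: contrapT.
have := ae_foralln (fun M => ae_foralln (bad M)).
apply: filterS => w nbad.
have zM : A (Num.truncn (z N w)).+1 w.
  by rewrite /A /= in_itv/= ltW// truncnS_gt.
apply/cvgr0Pnorm_lt => e e0.
(* The level is [e^2] because [W n w] is the square of [n^(eta/2) * y n w]. *)
have e20 : 0 < e ^+ 2 by rewrite exprn_gt0.
have [j _ /(_ j (leqnn j)) /= hj] := near_infty_natSinv_lt (PosNum e20).
have := nbad (Num.truncn (z N w)).+1 j.
move=> /not_andP[//|/existsNP[m hm]].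
exists m => // n /= mn.
have Wn : W n w < e ^+ 2.
  apply: lt_trans hj; rewrite ltNge; apply/negP => jW; apply: hm.
  by exists n.
rewrite dist_set_segment ?(ltW c0)// -/c -/(y n w).
have y0 : 0 <= y n w by rewrite le_max lexx orbT.
rewrite ger0_norm ?mulr_ge0 ?powR_ge0//.
rewrite -(ltr_pXn2r (n := 2)) ?nnegrE ?mulr_ge0 ?powR_ge0 ?(ltW e0)//.
apply: le_lt_trans Wn; rewrite exprMn /W ler_wpM2r ?sqr_ge0//.
by rewrite -powR_mulrn ?powR_ge0// -powRrM divfK.
Qed.
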